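(* The full polymorphic $\lambda$-calculus $\mathbf{F}_{\forall,\exists,\to,\wedge,\vee,\bot}$ is strongly normalizing: for every term $M$ of $\mathbf{F}_{\forall,\exists,\to,\wedge,\vee,\bot}$ there is no infinite sequence $M = M_0\to M_1\to M_2\to\cdots$, where $\to$ is the union of $\beta$-reduction $\to_\beta$ and commutative (permutative) reduction $\rightsquigarrow$.
   Context: Types of $\mathbf{F}_{\forall,\exists,\to,\wedge,\vee,\bot}$: $\sigma,\tau ::= p,q,\ldots \mid \sigma\to\tau\mid\sigma\wedge\tau\mid\sigma\vee\tau\mid\forall p\,\tau\mid\exists p\,\tau\mid\bot$, where $p,q,\ldots$ are type variables. Terms are in Church style (a superscript indicates the type of a term) and are considered up to $\alpha$-conversion. They are: variables $x^\sigma$; introductions $(\lambda x^\sigma.N^\tau)^{\sigma\to\tau}$, $\langle M^\sigma,N^\tau\rangle^{\sigma\wedge\tau}$, $(\mathtt{in}_1 A^\sigma)^{\sigma\vee\tau}$, $(\mathtt{in}_2 B^\tau)^{\sigma\vee\tau}$, $[M^{\tau[p:=\sigma]},\sigma]^{\exists p\,\tau}$, $(\Lambda p\,M^\tau)^{\forall p\,\tau}$ (with $p$ not free in the types of the free variables of $M$); eliminations $(M^{\sigma\to\tau}N^\sigma)^\tau$, $(P^{\sigma\wedge\tau}\pi_1)^\sigma$, $(P^{\sigma\wedge\tau}\pi_2)^\tau$, $(W^{\sigma\vee\tau}[x^\sigma.S^\delta,y^\tau.T^\delta])^\delta$ (case analysis, $x$ bound in $S$, $y$ bound in $T$), $(M^{\exists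 p\,\tau}[x^\tau.N^\delta])^\delta$ (with $x$ and $p$ bound in $N$, and $p$ not free in $\delta$ nor in the types of the free variables of $N$ other than $x$), $(M^{\forall p\,\tau}\sigma)^{\tau[p:=\sigma]}$, $(A^\bot\epsilon_\tau)^\tau$ (ex falso). An eliminator $E$ is any of: a term $N$ (application), $\pi_1$, $\pi_2$, $[a.A,b.B]$, $[a.N]$ (existential), a type $\sigma$, $\epsilon_\alpha$; an elimination term is written $ME$. $\beta$-rules: $(\lambda x^\tau.M)A \to_\beta M[x:=A]$; $\langle M,N\rangle\pi_1\to_\beta M$; $\langle M,N\rangle\pi_2\to_\beta N$; $(\mathtt{in}_1 A)[x.S,y.T]\to_\beta S[x:=A]$; $(\mathtt{in}_2 B)[x.S,y.T]\to_\beta T[y:=B]$; $[M^{\tau[p:=\sigma]},\sigma][x^\tau.N]\to_\beta N[p:=\sigma][x:=M]$; $(\Lambda p\,M)\sigma\to_\beta M[p:=\sigma]$. Commutative rules, for every eliminator $E$ such that the left-hand side is well typed (bound variables renamed to avoid capture): (1) $(W[x.S,y.T])E\rightsquigarrow W[x.SE,\,y.TE]$; (2) $(A^\bot\epsilon_\rho)E\rightsquigarrow A\,\epsilon_{\rho'}$, where $\rho'$ is the type of $(A\epsilon_\rho)E$; (3) $(M[x.P])E\rightsquigarrow M[x.PE]$, where $M$ has existential type. (These three patterns with the seven kinds of eliminator give 21 rules.) Both $\to_\beta$ and $\rightsquigarrow$ denote the compatible closures of these rules, i.e. a rule may be applied to any subterm. *)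

(* Defs.v *)
From Stdlib Require Import List.
Import ListNotations.

(* Types and terms are considered up to alpha-conversion: both are encoded with
   de Bruijn indices, in two separate index spaces (type variables and term
   variables). *)

Inductive ty : Type :=
| TVar (p : nat)
| Arr (s t : ty)
| And (s t : ty)
| Or (s t : ty)
| All (t : ty)   (* binds type variable 0 in t *)
| Ex (t : ty)    (* binds type variable 0 in t *)
| Bot.

(* Prepends an element to a (simultaneous) substitution. *)
Definition scons {X : Type} (a : X) (f : nat -> X) (n : nat) : X :=
  match n with
  | 0 => a
  | S m => f m
  end.

Definition up_ren (r : nat -> nat) : nat -> nat := scons 0 (fun n => S (r n)).

Fixpoint ty_ren (r : nat -> nat) (t : ty) : ty :=
  match t with
  | TVar p => TVar (r p)
  | Arr a b => Arr (ty_ren r a) (ty_ren r b)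
  | And a b => And (ty_ren r a) (ty_ren r b)
  | Or a b => Or (ty_ren r a) (ty_ren r b)
  | All a => All (ty_ren (up_ren r) a)
  | Ex a => Ex (ty_ren (up_ren r) a)
  | Bot => Bot
  end.

Definition ty_up (f : nat -> ty) : nat -> ty :=
  scons (TVar 0) (fun n => ty_ren S (f n)).

Fixpoint ty_subst (f : nat -> ty) (t : ty) : ty :=
  match t with
  | TVar p => f p
  | Arr a b => Arr (ty_subst f a) (ty_subst f b)
  | And a b => And (ty_subst f a) (ty_subst f b)
  | Or a b => Or (ty_subst f a) (ty_subst f b)
  | All a => All (ty_subst (ty_up f) a)
  | Ex a => Ex (ty_subst (ty_up f) a)
  | Bot => Bot
  end.

Definition wk_ty : nat -> ty := fun n => TVar (S n).

Definition ty_shift (t : ty) : ty := ty_subst wk_ty t.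

(* t[p := s], where p is type variable 0 of t. *)
Definition ty_inst (t s : ty) : ty := ty_subst (scons s TVar) t.

(* Terms in Church style.  Bound term variables carry their type, and the
   introductions carry exactly the type information that is not determined by
   their subterms, so that a term has at most one type in a given context. *)
Inductive tm : Type :=
| Var (x : nat)
| Lam (s : ty) (N : tm)                        (* lambda x^s. N *)
| Pair (M N : tm)
| In1 (t : ty) (A : tm)                        (* of type s \/ t, for A of type s *)
| In2 (s : ty) (B : tm)                        (* of type s \/ t, for B of type t *)
| Pack (M : tm) (s : ty) (t : ty)              (* [M, s] of type Ex t; t is under a binder *)
| TLam (M : tm)                                (* binds type variable 0 in M *)
| App (M N : tm)
| Pi1 (P : tm)
| Pi2 (P : tm)
| Case (W : tm) (s : ty) (U : tm) (t : ty) (V : tm)  (* W [x^s. U, y^t. V] *)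
| Unpack (M : tm) (t : ty) (N : tm)            (* M [x^t. N]; binds type variable 0 in t
                                                  and N, and term variable 0 in N *)
| TApp (M : tm) (s : ty)
| Eps (A : tm) (t : ty).                       (* A eps_t *)

Fixpoint tm_tsubst (f : nat -> ty) (M : tm) : tm :=
  match M with
  | Var x => Var x
  | Lam s N => Lam (ty_subst f s) (tm_tsubst f N)
  | Pair M N => Pair (tm_tsubst f M) (tm_tsubst f N)
  | In1 t A => In1 (ty_subst f t) (tm_tsubst f A)
  | In2 s B => In2 (ty_subst f s) (tm_tsubst f B)
  | Pack M s t => Pack (tm_tsubst f M) (ty_subst f s) (ty_subst (ty_up f) t)
  | TLam M => TLam (tm_tsubst (ty_up f) M)
  | App M N => App (tm_tsubst f M) (tm_tsubst f N)
  | Pi1 P => Pi1 (tm_tsubst f P)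
  | Pi2 P => Pi2 (tm_tsubst f P)
  | Case W s U t V =>
      Case (tm_tsubst f W) (ty_subst f s) (tm_tsubst f U)
           (ty_subst f t) (tm_tsubst f V)
  | Unpack M t N =>
      Unpack (tm_tsubst f M) (ty_subst (ty_up f) t) (tm_tsubst (ty_up f) N)
  | TApp M s => TApp (tm_tsubst f M) (ty_subst f s)
  | Eps A t => Eps (tm_tsubst f A) (ty_subst f t)
  end.

Definition tm_tshift (M : tm) : tm := tm_tsubst wk_ty M.

(* M[p := s], where p is type variable 0 of M. *)
Definition tm_tinst (M : tm) (s : ty) : tm := tm_tsubst (scons s TVar) M.

Fixpoint tm_ren (r : nat -> nat) (M : tm) : tm :=
  match M with
  | Var x => Var (r x)
  | Lam s N => Lam s (tm_ren (up_ren r) N)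
  | Pair M N => Pair (tm_ren r M) (tm_ren r N)
  | In1 t A => In1 t (tm_ren r A)
  | In2 s B => In2 s (tm_ren r B)
  | Pack M s t => Pack (tm_ren r M) s t
  | TLam M => TLam (tm_ren r M)
  | App M N => App (tm_ren r M) (tm_ren r N)
  | Pi1 P => Pi1 (tm_ren r P)
  | Pi2 P => Pi2 (tm_ren r P)
  | Case W s U t V =>
      Case (tm_ren r W) s (tm_ren (up_ren r) U) t (tm_ren (up_ren r) V)
  | Unpack M t N => Unpack (tm_ren r M) t (tm_ren (up_ren r) N)
  | TApp M s => TApp (tm_ren r M) s
  | Eps A t => Eps (tm_ren r A) t
  end.

Definition tm_shift (M : tm) : tm := tm_ren S M.

Definition tm_up (f : nat -> tm) : nat -> tm :=
  scons (Var 0) (fun n => tm_shift (f n)).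

(* Lifting under a type binder: the substituted terms have their type variables
   shifted. *)
Definition tm_tup (f : nat -> tm) : nat -> tm := fun n => tm_tshift (f n).

Fixpoint tm_subst (f : nat -> tm) (M : tm) : tm :=
  match M with
  | Var x => f x
  | Lam s N => Lam s (tm_subst (tm_up f) N)
  | Pair M N => Pair (tm_subst f M) (tm_subst f N)
  | In1 t A => In1 t (tm_subst f A)
  | In2 s B => In2 s (tm_subst f B)
  | Pack M s t => Pack (tm_subst f M) s t
  | TLam M => TLam (tm_subst (tm_tup f) M)
  | App M N => App (tm_subst f M) (tm_subst f N)
  | Pi1 P => Pi1 (tm_subst f P)
  | Pi2 P => Pi2 (tm_subst f P)
  | Case W s U t V =>
      Case (tm_subst f W) s (tm_subst (tm_up f) U) t (tm_subst (tm_up f) V)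
  | Unpack M t N => Unpack (tm_subst f M) t (tm_subst (tm_up (tm_tup f)) N)
  | TApp M s => TApp (tm_subst f M) s
  | Eps A t => Eps (tm_subst f A) t
  end.

(* M[x := A], where x is term variable 0 of M. *)
Definition tm_inst (M A : tm) : tm := tm_subst (scons A Var) M.

(* A context lists the types of the free term variables: entry n is the type
   carried by variable n.  Type variables need no declaration.  The conditions
   that p is not free in the types of the free variables, nor in the result type
   of an existential elimination, are expressed by shifting those types. *)
Definition ctx := list ty.

Definition ctx_shift (G : ctx) : ctx := map ty_shift G.

Inductive has_type : ctx -> tm -> ty -> Prop :=
| T_Var G x t :
    nth_error G x = Some t -> has_type G (Var x) t
| T_Lam G s N t :
    has_type (s :: G) N t -> has_type G (Lam s N) (Arr s t)
| T_Pair G M N s t :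
    has_type G M s -> has_type G N t -> has_type G (Pair M N) (And s t)
| T_In1 G A s t :
    has_type G A s -> has_type G (In1 t A) (Or s t)
| T_In2 G B s t :
    has_type G B t -> has_type G (In2 s B) (Or s t)
| T_Pack G M s t :
    has_type G M (ty_inst t s) -> has_type G (Pack M s t) (Ex t)
| T_TLam G M t :
    has_type (ctx_shift G) M t -> has_type G (TLam M) (All t)
| T_App G M N s t :
    has_type G M (Arr s t) -> has_type G N s -> has_type G (App M N) t
| T_Pi1 G P s t :
    has_type G P (And s t) -> has_type G (Pi1 P) s
| T_Pi2 G P s t :
    has_type G P (And s t) -> has_type G (Pi2 P) t
| T_Case G W s U t V d :
    has_type G W (Or s t) ->
    has_type (s :: G) U d -> has_type (t :: G) V d ->
    has_type G (Case W s U t V) d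
| T_Unpack G M t N d :
    has_type G M (Ex t) ->
    has_type (t :: ctx_shift G) N (ty_shift d) ->
    has_type G (Unpack M t N) d
| T_TApp G M s t :
    has_type G M (All t) -> has_type G (TApp M s) (ty_inst t s)
| T_Eps G A t :
    has_type G A Bot -> has_type G (Eps A t) t.

Inductive elim : Type :=
| EApp (N : tm)
| EPi1
| EPi2
| ECase (s : ty) (U : tm) (t : ty) (V : tm)
| EUnpack (t : ty) (N : tm)
| ETApp (s : ty)
| EEps (t : ty).

(* The elimination term M E. *)
Definition plug (M : tm) (E : elim) : tm :=
  match E with
  | EApp N => App M N
  | EPi1 => Pi1 M
  | EPi2 => Pi2 M
  | ECase s U t V => Case M s U t V
  | EUnpack t N => Unpack M t N
  | ETApp s => TApp M s
  | EEps t => Eps M t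
  end.

Definition elim_shift (E : elim) : elim :=
  match E with
  | EApp N => EApp (tm_shift N)
  | EPi1 => EPi1
  | EPi2 => EPi2
  | ECase s U t V => ECase s (tm_ren (up_ren S) U) t (tm_ren (up_ren S) V)
  | EUnpack t N => EUnpack t (tm_ren (up_ren S) N)
  | ETApp s => ETApp s
  | EEps t => EEps t
  end.

Definition elim_tshift (E : elim) : elim :=
  match E with
  | EApp N => EApp (tm_tshift N)
  | EPi1 => EPi1
  | EPi2 => EPi2
  | ECase s U t V => ECase (ty_shift s) (tm_tshift U) (ty_shift t) (tm_tshift V)
  | EUnpack t N =>
      EUnpack (ty_subst (ty_up wk_ty) t) (tm_tsubst (ty_up wk_ty) N)
  | ETApp s => ETApp (ty_shift s)
  | EEps t => EEps (ty_shift t)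
  end.

Inductive beta_rule : tm -> tm -> Prop :=
| Beta_Arr t M A :
    beta_rule (App (Lam t M) A) (tm_inst M A)
| Beta_Pi1 M N :
    beta_rule (Pi1 (Pair M N)) M
| Beta_Pi2 M N :
    beta_rule (Pi2 (Pair M N)) N
| Beta_In1 s t A U V :
    beta_rule (Case (In1 t A) s U t V) (tm_inst U A)
| Beta_In2 s t B U V :
    beta_rule (Case (In2 s B) s U t V) (tm_inst V B)
| Beta_Ex s t M N :
    beta_rule (Unpack (Pack M s t) t N) (tm_inst (tm_tinst N s) M)
| Beta_All M s :
    beta_rule (TApp (TLam M) s) (tm_tinst M s).

(* The context is needed because the second rule refers to the type of its
   left-hand side. *)
Inductive comm_rule (G : ctx) : tm -> tm -> Prop :=
| Comm_Case W s U t V E r :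
    has_type G (plug (Case W s U t V) E) r ->
    comm_rule G (plug (Case W s U t V) E)
                (Case W s (plug U (elim_shift E)) t (plug V (elim_shift E)))
| Comm_Eps A d E r :
    has_type G (plug (Eps A d) E) r ->
    comm_rule G (plug (Eps A d) E) (Eps A r)
| Comm_Unpack M t P E r :
    has_type G (plug (Unpack M t P) E) r ->
    comm_rule G (plug (Unpack M t P) E)
                (Unpack M t (plug P (elim_shift (elim_tshift E)))).

(* Compatible closure; the context follows the binders that are crossed. *)
Inductive compat (R : ctx -> tm -> tm -> Prop) : ctx -> tm -> tm -> Prop :=
| C_Root G M M' : R G M M' -> compat R G M M'
| C_Lam G s N N' :
    compat R (s :: G) N N' -> compat R G (Lam s N) (Lam s N')
| C_PairL G M M' N :
    compat R G M M' -> compat R G (Pair M N) (Pair M' N)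
| C_PairR G M N N' :
    compat R G N N' -> compat R G (Pair M N) (Pair M N')
| C_In1 G t A A' :
    compat R G A A' -> compat R G (In1 t A) (In1 t A')
| C_In2 G s B B' :
    compat R G B B' -> compat R G (In2 s B) (In2 s B')
| C_Pack G M M' s t :
    compat R G M M' -> compat R G (Pack M s t) (Pack M' s t)
| C_TLam G M M' :
    compat R (ctx_shift G) M M' -> compat R G (TLam M) (TLam M')
| C_AppL G M M' N :
    compat R G M M' -> compat R G (App M N) (App M' N)
| C_AppR G M N N' :
    compat R G N N' -> compat R G (App M N) (App M N')
| C_Pi1 G P P' :
    compat R G P P' -> compat R G (Pi1 P) (Pi1 P')
| C_Pi2 G P P' :
    compat R G P P' -> compat R G (Pi2 P) (Pi2 P')
| C_CaseW G W W' s U t V :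
    compat R G W W' -> compat R G (Case W s U t V) (Case W' s U t V)
| C_CaseS G W s U U' t V :
    compat R (s :: G) U U' -> compat R G (Case W s U t V) (Case W s U' t V)
| C_CaseT G W s U t V V' :
    compat R (t :: G) V V' -> compat R G (Case W s U t V) (Case W s U t V')
| C_UnpackM G M M' t N :
    compat R G M M' -> compat R G (Unpack M t N) (Unpack M' t N)
| C_UnpackN G M t N N' :
    compat R (t :: ctx_shift G) N N' -> compat R G (Unpack M t N) (Unpack M t N')
| C_TApp G M M' s :
    compat R G M M' -> compat R G (TApp M s) (TApp M' s)
| C_Eps G A A' t :
    compat R G A A' -> compat R G (Eps A t) (Eps A' t).

Definition beta : ctx -> tm -> tm -> Prop := compat (fun _ => beta_rule).

Definition comm : ctx -> tm -> tm -> Prop := compat comm_rule.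

Definition red (G : ctx) (M N : tm) : Prop := beta G M N \/ comm G M N.

(* Main.v *)
From Stdlib Require Import List PeanoNat Wf_nat FunctionalExtensionality Relations.
Require Import Defs.
Import ListNotations.

(* Types are erased, every typed reduction step becoming at least one step on
   untyped terms, so that strong normalization of the erased terms suffices.
   A type is interpreted not as a set of terms but as a set of stacks of
   eliminators, and a term realizes it if it is strongly normalizing on each of
   these stacks.  Commutative steps then happen inside a stack, where they merge
   two adjacent eliminators into one: they make the stack shorter without
   changing what the branches of a case analysis compute on it, so reducibility
   needs no closure condition specific to them.  Second-order quantifiers range
   over all candidates, the sets of strongly normalizing stacks containing the
   empty one. *)

(** * Untyped terms *)

Inductive uterm : Type :=
| UVar (x : nat)
| ULam (M : uterm)
| UPair (M N : uterm)
| UInj (b : bool) (A : uterm)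
| UApp (M N : uterm)
| UProj (b : bool) (P : uterm)
| UCase (W U V : uterm)
| UEps (A : uterm).

Fixpoint uren (r : nat -> nat) (M : uterm) : uterm :=
  match M with
  | UVar x => UVar (r x)
  | ULam M => ULam (uren (up_ren r) M)
  | UPair M N => UPair (uren r M) (uren r N)
  | UInj b A => UInj b (uren r A)
  | UApp M N => UApp (uren r M) (uren r N)
  | UProj b P => UProj b (uren r P)
  | UCase W U V => UCase (uren r W) (uren (up_ren r) U) (uren (up_ren r) V)
  | UEps A => UEps (uren r A)
  end.

Definition uup (f : nat -> uterm) : nat -> uterm :=
  scons (UVar 0) (fun n => uren S (f n)).

Fixpoint usubst (f : nat -> uterm) (M : uterm) : uterm :=
  match M with
  | UVar x => f x
  | ULam M => ULam (usubst (uup f) M)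
  | UPair M N => UPair (usubst f M) (usubst f N)
  | UInj b A => UInj b (usubst f A)
  | UApp M N => UApp (usubst f M) (usubst f N)
  | UProj b P => UProj b (usubst f P)
  | UCase W U V => UCase (usubst f W) (usubst (uup f) U) (usubst (uup f) V)
  | UEps A => UEps (usubst f A)
  end.

Definition uinst (M A : uterm) : uterm := usubst (scons A UVar) M.

Inductive frame : Type :=
| FApp (N : uterm)
| FProj (b : bool)
| FCase (U V : uterm)
| FEps.

Definition uplug (M : uterm) (E : frame) : uterm :=
  match E with
  | FApp N => UApp M N
  | FProj b => UProj b M
  | FCase U V => UCase M U V
  | FEps => UEps M
  end.

Definition fshift (E : frame) : frame :=
  match E with
  | FApp N => FApp (uren S N)
  | FProj b => FProj b
  | FCase U V => FCase (uren (up_ren S) U) (uren (up_ren S) V)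
  | FEps => FEps
  end.

Definition fsubst (f : nat -> uterm) (E : frame) : frame :=
  match E with
  | FApp N => FApp (usubst f N)
  | FProj b => FProj b
  | FCase U V => FCase (usubst (uup f) U) (usubst (uup f) V)
  | FEps => FEps
  end.

(** * Substitution calculus of untyped terms *)

Lemma usubst_ext f g M : (forall n, f n = g n) -> usubst f M = usubst g M.
Proof. intros H; f_equal; extensionality n; apply H. Qed.

Lemma uren_usubst r M : uren r M = usubst (fun n => UVar (r n)) M.
Proof.
  assert (Hup : forall q, uup (fun n => UVar (q n)) = fun n => UVar (up_ren q n)).
  { intros q; extensionality n; destruct n; reflexivity. }
  revert r; induction M; intros r; simpl;
    rewrite ?IHM, ?IHM1, ?IHM2, ?IHM3, ?Hup; reflexivity.
Qed.

Lemma usubst_uren f r M : usubst f (uren r M) = usubst (fun n => f (r n)) M.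
Proof.
  assert (Hup : forall g q, (fun n => uup g (up_ren q n)) = uup (fun n => g (q n))).
  { intros g q; extensionality n; destruct n; reflexivity. }
  revert f r; induction M; intros f r; simpl;
    rewrite ?IHM, ?IHM1, ?IHM2, ?IHM3, ?Hup; reflexivity.
Qed.

Lemma uren_uren r q M : uren r (uren q M) = uren (fun n => r (q n)) M.
Proof. now rewrite (uren_usubst r), usubst_uren, uren_usubst. Qed.

Lemma uren_after_usubst r f M :
  uren r (usubst f M) = usubst (fun n => uren r (f n)) M.
Proof.
  assert (Hup : forall q g,
    (fun n => uren (up_ren q) (uup g n)) = uup (fun n => uren q (g n))).
  { intros q g; extensionality n; destruct n; simpl; [reflexivity|].
    now rewrite !uren_uren. }
  revert r f; induction M; intros r f; simpl;
    rewrite ?IHM, ?IHM1, ?IHM2, ?IHM3, ?Hup; reflexivity.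
Qed.

Lemma usubst_shift f M : usubst (uup f) (uren S M) = uren S (usubst f M).
Proof. now rewrite usubst_uren, uren_after_usubst. Qed.

Lemma usubst_usubst g f M :
  usubst g (usubst f M) = usubst (fun n => usubst g (f n)) M.
Proof.
  assert (Hup : forall h k,
    (fun n => usubst (uup h) (uup k n)) = uup (fun n => usubst h (k n))).
  { intros h k; extensionality n; destruct n; simpl; [reflexivity|].
    apply usubst_shift. }
  revert g f; induction M; intros g f; simpl;
    rewrite ?IHM, ?IHM1, ?IHM2, ?IHM3, ?Hup; reflexivity.
Qed.

Lemma usubst_id M : usubst UVar M = M.
Proof.
  assert (Hup : uup UVar = UVar) by (extensionality n; destruct n; reflexivity).
  induction M; simpl; rewrite ?Hup; congruence.
Qed.

Lemma uinst_uup f M A : uinst (usubst (uup f) M) A = usubst (scons A f) M.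
Proof.
  unfold uinst; rewrite usubst_usubst; apply usubst_ext.
  intros [|n]; simpl; [reflexivity|].
  rewrite usubst_uren; apply usubst_id.
Qed.

Lemma usubst_uinst f M A :
  usubst f (uinst M A) = uinst (usubst (uup f) M) (usubst f A).
Proof.
  rewrite uinst_uup; unfold uinst; rewrite usubst_usubst; apply usubst_ext.
  now intros [|n].
Qed.

Lemma usubst_plug f M E : usubst f (uplug M E) = uplug (usubst f M) (fsubst f E).
Proof. now destruct E. Qed.

Lemma fsubst_fshift f E : fsubst (uup f) (fshift E) = fshift (fsubst f E).
Proof.
  assert (Hup : forall M, usubst (uup (uup f)) (uren (up_ren S) M)
                          = uren (up_ren S) (usubst (uup f) M)).
  { intros M; rewrite usubst_uren, uren_after_usubst; apply usubst_ext.
    intros [|n]; simpl; [reflexivity|]. now rewrite !uren_uren. }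
  destruct E; simpl; rewrite ?usubst_shift, ?Hup; reflexivity.
Qed.

(** The shifted eliminator cannot mention the instantiated variable. So moving an eliminator into a
    branch and then contracting gives the same term as contracting first. *)
Lemma uinst_plug_fshift M E A : uinst (uplug M (fshift E)) A = uplug (uinst M A) E.
Proof.
  assert (Hup : forall N, usubst (uup (scons A UVar)) (uren (up_ren S) N) = N).
  { intros N; rewrite usubst_uren; etransitivity; [|apply usubst_id].
    apply usubst_ext; now intros [|n]. }
  unfold uinst; rewrite usubst_plug.
  destruct E; simpl; rewrite ?Hup, ?usubst_uren; try reflexivity.
  f_equal; apply usubst_id.
Qed.

(** * Reduction of untyped terms *)

(* [fuse F E F']: the commutative rules, as a merge of two adjacent eliminators. *)
Inductive fuse : frame -> frame -> frame -> Prop :=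
| fuse_case U V E :
    fuse (FCase U V) E (FCase (uplug U (fshift E)) (uplug V (fshift E)))
| fuse_eps E : fuse FEps E FEps.

Inductive cut : uterm -> frame -> uterm -> Prop :=
| cut_lam M A : cut (ULam M) (FApp A) (uinst M A)
| cut_pair b M N : cut (UPair M N) (FProj b) (if b then M else N)
| cut_inj b A U V : cut (UInj b A) (FCase U V) (uinst (if b then U else V) A)
| cut_fuse M F E F' : fuse F E F' -> cut (uplug M F) E (uplug M F').

(** Congruence goes through [uplug] and the mutual relation [fstep], so that eliminations are
    analysed uniformly in the eliminator. *)
Inductive step : uterm -> uterm -> Prop :=
| step_lam M M' : step M M' -> step (ULam M) (ULam M')
| step_pairL M M' N : step M M' -> step (UPair M N) (UPair M' N)
| step_pairR M N N' : step N N' -> step (UPair M N) (UPair M N')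
| step_inj b A A' : step A A' -> step (UInj b A) (UInj b A')
| step_head M M' E : step M M' -> step (uplug M E) (uplug M' E)
| step_frame M E E' : fstep E E' -> step (uplug M E) (uplug M E')
| step_cut M E N : cut M E N -> step (uplug M E) N
with fstep : frame -> frame -> Prop :=
| fstep_app N N' : step N N' -> fstep (FApp N) (FApp N')
| fstep_caseL U U' V : step U U' -> fstep (FCase U V) (FCase U' V)
| fstep_caseR U V V' : step V V' -> fstep (FCase U V) (FCase U V').

Scheme step_mind := Minimality for step Sort Prop
with fstep_mind := Minimality for fstep Sort Prop.

Lemma fuse_fsubst f F E F' :
  fuse F E F' -> fuse (fsubst f F) (fsubst f E) (fsubst f F').
Proof.
  destruct 1; simpl; rewrite ?usubst_plug, ?fsubst_fshift; constructor.
Qed.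

Lemma cut_usubst f M E N :
  cut M E N -> cut (usubst f M) (fsubst f E) (usubst f N).
Proof.
  destruct 1; simpl; rewrite ?usubst_uinst, ?usubst_plug.
  - constructor.
  - destruct b; apply (cut_pair true) || apply (cut_pair false).
  - destruct b; apply (cut_inj true) || apply (cut_inj false).
  - constructor; now apply fuse_fsubst.
Qed.

Lemma step_usubst f M N : step M N -> step (usubst f M) (usubst f N).
Proof.
  intros H; revert f.
  (* The first ten premises of the scheme are the constructor cases; the eleventh is the
     derivation. *)
  apply (step_mind (fun M N => forall f, step (usubst f M) (usubst f N))
           (fun E E' => forall f, fstep (fsubst f E) (fsubst f E'))) with (11 := H);
    intros; rewrite ?usubst_plug; try (simpl; constructor; now auto).
  constructor; now apply cut_usubst.
Qed.

Definition steps : uterm -> uterm -> Prop := clos_refl_trans _ step.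

Lemma steps_map (h : uterm -> uterm) M N :
  (forall A B, step A B -> step (h A) (h B)) -> steps M N -> steps (h M) (h N).
Proof.
  intros Hh; induction 1; [apply rt_step; auto|apply rt_refl|eapply rt_trans; eauto].
Qed.

(** A variable may occur any number of times, so one step in a substituted term becomes zero or more
    steps. *)
Lemma steps_usubst_args f g M :
  (forall n, steps (f n) (g n)) -> steps (usubst f M) (usubst g M).
Proof.
  assert (Hup : forall f g, (forall n, steps (f n) (g n)) ->
                forall n, steps (uup f n) (uup g n)).
  { intros f' g' H [|n]; simpl; [apply rt_refl|].
    apply (steps_map (uren S)); [|apply H].
    intros A B HAB; rewrite !uren_usubst; now apply step_usubst. }
  revert f g; induction M; intros f g H; simpl.
  - apply H.
  - apply (steps_map ULam); [constructor; auto|auto].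
  - apply rt_trans with (UPair (usubst g M1) (usubst f M2)).
    + apply (steps_map (fun X => UPair X _)); [constructor; auto|auto].
    + apply (steps_map (UPair _)); [constructor; auto|auto].
  - apply (steps_map (UInj b)); [constructor; auto|auto].
  - apply rt_trans with (UApp (usubst g M1) (usubst f M2)).
    + apply (steps_map (fun X => uplug X (FApp _))); [constructor; auto|auto].
    + apply (steps_map (fun X => uplug _ (FApp X))); [do 2 constructor; auto|auto].
  - apply (steps_map (fun X => uplug X (FProj b))); [constructor; auto|auto].
  - apply rt_trans with (UCase (usubst g M1) (usubst (uup f) M2) (usubst (uup f) M3)).
    { apply (steps_map (fun X => uplug X (FCase _ _))); [constructor; auto|auto]. }
    apply rt_trans with (UCase (usubst g M1) (usubst (uup g) M2) (usubst (uup f) M3)).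
    + apply (steps_map (fun X => uplug _ (FCase X _))); [do 2 constructor; auto|auto].
    + apply (steps_map (fun X => uplug _ (FCase _ X))); [do 2 constructor; auto|auto].
  - apply (steps_map (fun X => uplug X FEps)); [constructor; auto|auto].
Qed.

Lemma steps_uinst_arg M A A' : step A A' -> steps (uinst M A) (uinst M A').
Proof.
  intros H; apply steps_usubst_args; intros [|n]; [now apply rt_step|apply rt_refl].
Qed.

Lemma uplug_inj M E N F : uplug M E = uplug N F -> M = N /\ E = F.
Proof. destruct E, F; simpl; intros H; inversion H; auto. Qed.

Lemma step_plug_inv M E N :
  step (uplug M E) N ->
  (exists M', step M M' /\ N = uplug M' E)
  \/ (exists E', fstep E E' /\ N = uplug M E') \/ cut M E N.
Proof.
  remember (uplug M E) as R eqn:HR; destruct 1;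
    try (destruct E; discriminate HR);
    apply uplug_inj in HR as [-> ->]; eauto.
Qed.

(** * Stacks *)

Definition stack : Type := list frame.

(** The head of the list is the innermost eliminator, applied directly to [M]. *)
Definition uplugs (M : uterm) (K : stack) : uterm := fold_left uplug K M.

(** These are the reductions of [uplugs M K] that are possible whatever [M] is; two adjacent frames
    interact only by fusion. *)
Inductive kstep : stack -> stack -> Prop :=
| kstep_frame E E' K : fstep E E' -> kstep (E :: K) (E' :: K)
| kstep_tail E K K' : kstep K K' -> kstep (E :: K) (E :: K')
| kstep_fuse F E F' K : fuse F E F' -> kstep (F :: E :: K) (F' :: K).

Lemma step_uplugs M M' K : step M M' -> step (uplugs M K) (uplugs M' K).
Proof. revert M M'; induction K; simpl; auto using step_head. Qed.

Lemma kstep_uplugs M K K' : kstep K K' -> step (uplugs M K) (uplugs M K').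
Proof.
  intros H; revert M; induction H; intros M; simpl; auto;
    apply step_uplugs; auto using step_frame, step_cut, cut_fuse.
Qed.

Lemma cut_plug_inv M F E N :
  cut (uplug M F) E N -> exists F', fuse F E F' /\ N = uplug M F'.
Proof.
  remember (uplug M F) as R eqn:HR; destruct 1; try (destruct F; discriminate HR).
  apply uplug_inj in HR as [-> ->]; eauto.
Qed.

(** Only the first frame can meet [M]. A cut further out has an elimination as its head, hence is a
    fusion of two frames and belongs to the stack. *)
Lemma step_uplugs_inv M K N :
  step (uplugs M K) N ->
  (exists M', step M M' /\ N = uplugs M' K)
  \/ (exists K', kstep K K' /\ N = uplugs M K')
  \/ (exists E K' M', K = E :: K' /\ cut M E M' /\ N = uplugs M' K').
Proof.
  revert M; induction K as [|E K IH]; simpl; intros M H; [eauto|].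
  destruct (IH _ H) as [(M' & HM & ->)|[(K' & HK & ->)|(F & K' & M' & -> & HC & ->)]].
  - apply step_plug_inv in HM as [(M1 & HM & ->)|[(E' & HE & ->)|HC]].
    + eauto.
    + right; left; exists (E' :: K); auto using kstep_frame.
    + do 2 right; eauto 6.
  - right; left; exists (E :: K'); auto using kstep_tail.
  - apply cut_plug_inv in HC as (F' & HF & ->).
    right; left; exists (F' :: K'); auto using kstep_fuse.
Qed.

Definition terminating {X : Type} (R : X -> X -> Prop) : X -> Prop :=
  Acc (fun y x => R x y).

Lemma terminating_preimage {X Y : Type} (R : X -> X -> Prop) (Q : Y -> Y -> Prop)
  (h : X -> Y) x :
  (forall a b, R a b -> Q (h a) (h b)) -> terminating Q (h x) -> terminating R x.
Proof.
  intros Hh H; remember (h x) as y eqn:Hy; revert x Hy.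
  induction H as [y _ IH]; intros x ->; constructor; intros z Hz.
  apply (IH (h z)); auto.
Qed.

Notation sn := (terminating step).
Notation ksn := (terminating kstep).

Lemma sn_step M N : sn M -> step M N -> sn N.
Proof. intros H; apply H. Qed.

Lemma sn_steps M N : steps M N -> sn M -> sn N.
Proof. induction 1; eauto using sn_step. Qed.

Lemma sn_uplugs_head M K : sn (uplugs M K) -> sn M.
Proof. apply (terminating_preimage step step (fun X => uplugs X K)); eauto using step_uplugs. Qed.

Lemma sn_uplugs_stack M K : sn (uplugs M K) -> ksn K.
Proof. apply (terminating_preimage kstep step (uplugs M)); eauto using kstep_uplugs. Qed.

Lemma ksn_tail E K : ksn (E :: K) -> ksn K.
Proof. apply (terminating_preimage kstep kstep (cons E)); eauto using kstep_tail. Qed.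

Lemma var_normal x N : ~ step (UVar x) N.
Proof.
  intros H; inversion H;
    match goal with HE : uplug _ ?E = _ |- _ => destruct E; discriminate HE end.
Qed.

Lemma sn_var x : sn (UVar x).
Proof. constructor; intros N H; now apply var_normal in H. Qed.

Ltac cut_inversion H :=
  inversion H; subst;
  try match goal with HE : uplug _ ?E = _ |- _ => destruct E; discriminate HE end.

(** A variable forms no cut with a frame, so every reduction takes place in the stack. *)
Lemma sn_var_uplugs x K : ksn K -> sn (uplugs (UVar x) K).
Proof.
  induction 1 as [K _ IH]; constructor; intros N HN.
  apply step_uplugs_inv in HN as [(M' & HM & ->)|[(K' & HK & ->)|(E & K' & M' & -> & HC & ->)]].
  - now apply var_normal in HM.
  - now apply IH.
  - cut_inversion HC.
Qed.

Lemma ksn_nil : ksn [].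
Proof. constructor; intros K H; inversion H. Qed.

(** An application frame does not absorb the frame after it, so [N] and [K] reduce independently. *)
Lemma ksn_app N K : sn N -> ksn K -> ksn (FApp N :: K).
Proof.
  intros HN; revert K; induction HN as [N _ IHN]; intros K HK.
  induction HK as [K HK IHK]; constructor; intros L HL; inversion HL; subst.
  - match goal with HF : fstep _ _ |- _ => inversion HF; subst end.
    apply IHN; auto. now constructor.
  - now apply IHK.
  - match goal with HF : fuse _ _ _ |- _ => inversion HF end.
Qed.

Lemma ksn_proj b K : ksn K -> ksn (FProj b :: K).
Proof.
  induction 1 as [K _ IH]; constructor; intros L HL; inversion HL; subst.
  - match goal with HF : fstep _ _ |- _ => inversion HF end.
  - now apply IH.
  - match goal with HF : fuse _ _ _ |- _ => inversion HF end.
Qed.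

Lemma kstep_length K L : kstep K L -> length L <= length K.
Proof. induction 1; simpl; auto using le_n_S. Qed.

(** [FEps] can absorb the frames of [K] one by one, which is not a reduction of [K] itself.
    Absorption shortens [K] and no step of [K] lengthens it, so the outer induction is on a bound
    for the length and the inner one on the termination of [K]. *)
Lemma ksn_eps K : ksn K -> ksn (FEps :: K).
Proof.
  assert (H : forall n K, length K <= n -> ksn K -> ksn (FEps :: K)); [|eauto].
  clear K; intros n; induction n as [|n IHn]; intros K Hn HK;
    revert Hn; induction HK as [K HK IHK]; intros Hn; constructor; intros L HL;
    inversion HL; subst;
    try match goal with HF : fstep _ _ |- _ => now inversion HF end.
  - apply IHK; [assumption|].
    eapply Nat.le_trans; [apply kstep_length; eassumption|assumption].
  - inversion Hn.
  - apply IHK; [assumption|].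
    eapply Nat.le_trans; [apply kstep_length; eassumption|assumption].
  - match goal with HF : fuse _ _ _ |- _ => inversion HF; subst end.
    apply IHn; [now apply le_S_n|]. apply ksn_tail with E; now constructor.
Qed.

(** Steps in [M] or in [K] are matched by steps of the contractum. A step in [A] may leave the
    contractum unchanged, since [M] may discard its argument; hence the separate assumption on [A],
    whose induction comes first. *)
Lemma sn_beta_lam M A K :
  sn A -> sn (uplugs (uinst M A) K) -> sn (uplugs (ULam M) (FApp A :: K)).
Proof.
  intros HA; revert M K; induction HA as [A HA IHA]; intros M K H.
  remember (uplugs (uinst M A) K) as R eqn:HR; revert M K HR.
  induction H as [R HR' IH]; intros M K ->; constructor; intros N HN.
  apply step_uplugs_inv in HN as [(M' & HM & ->)|[(L & HL & ->)|(E & L & M' & HE & HC & ->)]].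
  - inversion HM; subst; try (destruct E; discriminate).
    eapply IH; [|reflexivity]. now apply step_uplugs, step_usubst.
  - inversion HL; subst.
    + match goal with HF : fstep _ _ |- _ => inversion HF; subst end.
      apply IHA; auto.
      apply sn_steps with (uplugs (uinst M A) K); [|now constructor].
      apply (steps_map (fun X => uplugs X K)); auto using step_uplugs, steps_uinst_arg.
    + eapply IH; [|reflexivity]. now apply kstep_uplugs.
    + match goal with HF : fuse _ _ _ |- _ => inversion HF end.
  - injection HE as <- <-. cut_inversion HC. now constructor.
Qed.

(** The component that is not selected still reduces inside the pair, so both must terminate by
    themselves. *)
Lemma sn_beta_pair (b : bool) M N K :
  sn M -> sn N -> sn (uplugs (if b then M else N) K) ->
  sn (uplugs (UPair M N) (FProj b :: K)).
Proof.
  intros HM; revert N K; induction HM as [M HM IHM].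
  intros N K HN; revert K; induction HN as [N HN IHN]; intros K H.
  remember (uplugs (if b then M else N) K) as R eqn:HR; revert K HR.
  induction H as [R HR' IH]; intros K ->; constructor; intros P HP.
  apply step_uplugs_inv in HP as [(M' & HS & ->)|[(L & HL & ->)|(E & L & M' & HE & HC & ->)]].
  - inversion HS; subst; try (destruct E; discriminate).
    + apply IHM; auto; [now constructor|].
      destruct b; [now apply HR', step_uplugs|now constructor].
    + apply IHN; auto.
      destruct b; [now constructor|now apply HR', step_uplugs].
  - inversion HL; subst.
    + match goal with HF : fstep _ _ |- _ => inversion HF end.
    + eapply IH; [|reflexivity]. now apply kstep_uplugs.
    + match goal with HF : fuse _ _ _ |- _ => inversion HF end.
  - injection HE as <- <-. cut_inversion HC. now constructor.
Qed.

(* Moving an eliminator of the stack into the branches changes neither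
   [uplugs (uinst U A) K] nor [uplugs (uinst V B) K] and shortens the stack. *)
Lemma sn_beta_inj (b : bool) A B U V K :
  sn A -> sn B -> sn (uplugs (uinst U A) K) -> sn (uplugs (uinst V B) K) ->
  sn (uplugs (UInj b (if b then A else B)) (FCase U V :: K)).
Proof.
  (* Only one of [A] and [B] occurs in the term. The other controls the reductions in the branch
     that is not selected, which remains present until the contraction. *)
  intros HA; revert B U V K; induction HA as [A HA IHA].
  intros B U V K HB; revert U V K; induction HB as [B HB IHB].
  intros U V K H; remember (uplugs (uinst U A) K) as Q eqn:HQ; revert U V K HQ.
  induction H as [Q HQ' IHQ].
  intros U V K HQ H; remember (uplugs (uinst V B) K) as R eqn:HR; revert U V K HQ HR.
  induction H as [R HR' IHR].
  intros U V K; revert U V.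
  (* The length of [K] comes last in the lexicographic order, after [A], [B] and the two contracta;
     it decreases when the case frame absorbs the first frame of [K]. *)
  induction K as [K IHK] using (induction_ltof1 _ (@length frame)).
  intros U V HQ HR; constructor; intros N HN.
  apply step_uplugs_inv in HN as [(M' & HS & ->)|[(L & HL & ->)|(E & L & M' & HE & HC & ->)]].
  - inversion HS; subst; try (destruct E; discriminate). destruct b.
    + apply IHA with B; [assumption|now constructor| |now constructor].
      apply sn_steps with (uplugs (uinst U A) K); [|now constructor].
      apply (steps_map (fun X => uplugs X K)); auto using step_uplugs, steps_uinst_arg.
    + apply IHB; [assumption|now constructor|].
      apply sn_steps with (uplugs (uinst V B) K); [|now constructor].
      apply (steps_map (fun X => uplugs X K)); auto using step_uplugs, steps_uinst_arg.
  - inversion HL; subst.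
    + match goal with HF : fstep _ _ |- _ => inversion HF; subst end.
      * eapply IHQ; [|reflexivity|now constructor]. now apply step_uplugs, step_usubst.
      * eapply IHR; [|reflexivity|reflexivity]. now apply step_uplugs, step_usubst.
    + eapply IHQ; [|reflexivity|]; [now apply kstep_uplugs|].
      apply HR'; now apply kstep_uplugs.
    + match goal with HF : fuse _ _ _ |- _ => inversion HF; subst end.
      apply IHK; [apply le_n| |]; now rewrite uinst_plug_fshift.
  - injection HE as <- <-; cut_inversion HC; destruct b; now constructor.
Qed.

(** * Interpretation of types *)

Definition realizes (X : stack -> Prop) (M : uterm) : Prop :=
  forall K, X K -> sn (uplugs M K).

(** The empty stack makes every realizer strongly normalizing; the termination of the stacks makes
    every variable a realizer. *)
Definition candidate (X : stack -> Prop) : Prop :=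
  X [] /\ forall K, X K -> ksn K.

(** For [Arr], [And] and [All] the stacks start with the matching eliminator; the empty stack is
    added because candidates must contain it. *)
Definition arr_stacks (X Y : stack -> Prop) (K : stack) : Prop :=
  K = [] \/ exists N L, K = FApp N :: L /\ realizes X N /\ Y L.

Definition and_stacks (X Y : stack -> Prop) (K : stack) : Prop :=
  K = [] \/ exists (b : bool) L, K = FProj b :: L /\ (if b then X else Y) L.

(** For [Or] and [Ex] the stacks are those on which all introductions of realizers terminate. The
    result type of the elimination, which is arbitrary, thus stays out of the definition. *)
Definition or_stacks (X Y : stack -> Prop) (K : stack) : Prop :=
  forall (b : bool) A, realizes (if b then X else Y) A -> sn (uplugs (UInj b A) K).

(** An intersection over candidates on the side of realizers is a union on the side of stacks.
    [FProj true] is the erased type application. *)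
Definition all_stacks (F : (stack -> Prop) -> stack -> Prop) (K : stack) : Prop :=
  K = [] \/ exists X L, K = FProj true :: L /\ candidate X /\ F X L.

Definition ex_stacks (F : (stack -> Prop) -> stack -> Prop) (K : stack) : Prop :=
  forall X A, candidate X -> realizes (F X) A -> sn (uplugs (UInj true A) K).

(** [Bot] receives the largest candidate, and thus the fewest realizers. *)
Fixpoint interp (t : ty) (v : nat -> stack -> Prop) : stack -> Prop :=
  match t with
  | TVar p => v p
  | Arr s t => arr_stacks (interp s v) (interp t v)
  | And s t => and_stacks (interp s v) (interp t v)
  | Or s t => or_stacks (interp s v) (interp t v)
  | All t => all_stacks (fun X => interp t (scons X v))
  | Ex t => ex_stacks (fun X => interp t (scons X v))
  | Bot => ksn
  end.

Lemma interp_ren r t v : interp (ty_ren r t) v = interp t (fun n => v (r n)).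
Proof.
  assert (Hup : forall q w (X : stack -> Prop),
    (fun n => scons X w (up_ren q n)) = scons X (fun n => w (q n))).
  { intros q w X; extensionality n; destruct n; reflexivity. }
  revert r v; induction t; intros r v; simpl; f_equal; auto;
    extensionality X; rewrite IHt; now rewrite Hup.
Qed.

Lemma interp_subst f t v :
  interp (ty_subst f t) v = interp t (fun n => interp (f n) v).
Proof.
  assert (Hup : forall g w X,
    (fun n => interp (ty_up g n) (scons X w)) = scons X (fun n => interp (g n) w)).
  { intros g w X; extensionality n; destruct n; [reflexivity|apply interp_ren]. }
  revert f v; induction t; intros f v; simpl; f_equal; auto;
    extensionality X; rewrite IHt; now rewrite Hup.
Qed.

Lemma interp_shift t X v : interp (ty_shift t) (scons X v) = interp t v.
Proof. apply interp_subst. Qed.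

Lemma interp_inst t s v : interp (ty_inst t s) v = interp t (scons (interp s v) v).
Proof.
  unfold ty_inst; rewrite interp_subst; f_equal; extensionality n; now destruct n.
Qed.

Lemma realizes_sn X M : candidate X -> realizes X M -> sn M.
Proof. intros [H _] HM; apply (HM _ H). Qed.

Lemma realizes_var X x : candidate X -> realizes X (UVar x).
Proof. intros [_ H] K HK; auto using sn_var_uplugs. Qed.

Lemma sn_inj b A : sn A -> sn (UInj b A).
Proof.
  induction 1 as [A _ IH]; constructor; intros N H; inversion H; subst;
    try (destruct E; discriminate); now apply IH.
Qed.

Definition candidates (v : nat -> stack -> Prop) : Prop := forall n, candidate (v n).

Lemma candidates_scons X v : candidate X -> candidates v -> candidates (scons X v).
Proof. intros HX Hv [|n]; simpl; auto. Qed.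

Lemma candidate_ksn : candidate ksn.
Proof. split; auto using ksn_nil. Qed.

Lemma interp_candidate t v : candidates v -> candidate (interp t v).
Proof.
  revert v; induction t; intros v Hv; simpl.
  - apply Hv.
  - split; [now left|]. intros K [->|(N & L & -> & HN & HL)]; [apply ksn_nil|].
    apply ksn_app; [apply realizes_sn with (interp t1 v); auto|now apply IHt2 with v].
  - split; [now left|]. intros K [->|(b & L & -> & HL)]; [apply ksn_nil|].
    apply ksn_proj. destruct b; [now apply IHt1 with v|now apply IHt2 with v].
  - split.
    + intros b A HA; apply sn_inj. destruct b; eapply realizes_sn, HA; auto.
    (* The stack terminates because it can be applied to an injected variable, which comes from a
       realizer. *)
    + intros K HK; apply sn_uplugs_stack with (UInj true (UVar 0)).
      apply HK, realizes_var; auto.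
  - split; [now left|]. intros K [->|(X & L & -> & HX & HL)]; [apply ksn_nil|].
    apply ksn_proj. now apply (IHt (scons X v)); [apply candidates_scons|].
  - split.
    + intros X A HX HA; apply sn_inj. eapply realizes_sn; [|exact HA].
      auto using candidates_scons.
    + intros K HK; apply sn_uplugs_stack with (UInj true (UVar 0)).
      (* Some candidate has to be chosen for the bound type variable; [ksn] is one that is always
         available. *)
      apply (HK ksn); [apply candidate_ksn|].
      apply realizes_var; auto using candidates_scons, candidate_ksn.
  - apply candidate_ksn.
Qed.

Lemma realizes_case X Y Z W U V :
  candidate X -> candidate Y ->
  realizes (or_stacks X Y) W ->
  (forall A, realizes X A -> realizes Z (uinst U A)) ->
  (forall B, realizes Y B -> realizes Z (uinst V B)) ->
  realizes Z (UCase W U V).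
Proof.
  intros HX HY HW HU HV K HK.
  apply (HW (FCase U V :: K)); intros b A HA.
  destruct b.
  (* The variable is a dummy argument for the branch that is not selected: it realizes every
     candidate. *)
  - apply (sn_beta_inj true A (UVar 0)).
    + now apply realizes_sn with X.
    + apply sn_var.
    + now apply HU.
    + apply HV; auto using realizes_var.
  - apply (sn_beta_inj false (UVar 0) A).
    + apply sn_var.
    + now apply realizes_sn with Y.
    + apply HU; auto using realizes_var.
    + now apply HV.
Qed.

(** * Erasure *)

(* The images are chosen so that the reductions of the quantifiers become
   reductions of pairs and of injections; the two copies of [M] and of [N] make
   one typed step inside them two untyped steps. *)
Fixpoint erase (M : tm) : uterm :=
  match M with
  | Var x => UVar x
  | Lam _ N => ULam (erase N)
  | Pair M N => UPair (erase M) (erase N)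
  | In1 _ A => UInj true (erase A)
  | In2 _ B => UInj false (erase B)
  | Pack M _ _ => UInj true (erase M)
  | TLam M => UPair (erase M) (erase M)
  | App M N => UApp (erase M) (erase N)
  | Pi1 P => UProj true (erase P)
  | Pi2 P => UProj false (erase P)
  | Case W _ U _ V => UCase (erase W) (erase U) (erase V)
  | Unpack M _ N => UCase (erase M) (erase N) (erase N)
  | TApp M _ => UProj true (erase M)
  | Eps A _ => UEps (erase A)
  end.

Definition erase_elim (E : elim) : frame :=
  match E with
  | EApp N => FApp (erase N)
  | EPi1 => FProj true
  | EPi2 => FProj false
  | ECase _ U _ V => FCase (erase U) (erase V)
  | EUnpack _ N => FCase (erase N) (erase N)
  | ETApp _ => FProj true
  | EEps _ => FEps
  end.

(** Adequacy of the interpretation, by induction on the typing derivation. Lambdas and pairs are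
    handled by head expansion, injections by the definition of their stacks; an elimination pushes
    its frame onto the stack given to its head. *)
Lemma realizes_erase G M t v g :
  has_type G M t -> candidates v ->
  (forall x s, nth_error G x = Some s -> realizes (interp s v) (g x)) ->
  realizes (interp t v) (usubst g (erase M)).
Proof.
  assert (Hcons : forall G s v g A, realizes (interp s v) A ->
    (forall x s, nth_error G x = Some s -> realizes (interp s v) (g x)) ->
    forall x u, nth_error (s :: G) x = Some u -> realizes (interp u v) (scons A g x)).
  { intros G' s v' g' A HA Hg [|x] u Hu; simpl in *; [injection Hu as <-|]; auto. }
  assert (Hshift : forall G v g X,
    (forall x s, nth_error G x = Some s -> realizes (interp s v) (g x)) ->
    forall x s, nth_error (ctx_shift G) x = Some s ->
      realizes (interp s (scons X v)) (g x)).
  { intros G' v' g' X Hg x s Hs; unfold ctx_shift in Hs; rewrite nth_error_map in Hs.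
    destruct (nth_error G' x) as [u|] eqn:Hu; [|discriminate].
    injection Hs as <-. rewrite interp_shift; auto. }
  intros HM; revert v g; induction HM; intros v g Hv Hg; simpl.
  - now apply Hg.
  - assert (HL : forall A K, realizes (interp s v) A -> interp t v K ->
              sn (uplugs (ULam (usubst (uup g) (erase N))) (FApp A :: K))).
    { intros A K HA HK; apply sn_beta_lam.
      - eapply realizes_sn; [|exact HA]; now apply interp_candidate.
      - rewrite uinst_uup; apply (IHHM v (scons A g)); [exact Hv|now apply Hcons|exact HK]. }
    intros K [->|(A & L & -> & HA & HK)]; [|now apply HL].
    (* For the empty stack a frame is added and then dropped: the head of a strongly normalizing
       elimination is strongly normalizing. *)
    apply sn_uplugs_head with [FApp (UVar 0)], HL.
    + now apply realizes_var, interp_candidate.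
    + now apply interp_candidate.
  - assert (HP : forall (b : bool) K, (if b then interp s v else interp t v) K ->
              sn (uplugs (UPair (usubst g (erase M)) (usubst g (erase N))) (FProj b :: K))).
    { intros b K HK; apply sn_beta_pair.
      - eapply realizes_sn; [apply interp_candidate, Hv|]; now apply (IHHM1 v g Hv Hg).
      - eapply realizes_sn; [apply interp_candidate, Hv|]; now apply (IHHM2 v g Hv Hg).
      - destruct b; [now apply (IHHM1 v g Hv Hg)|now apply (IHHM2 v g Hv Hg)]. }
    intros K [->|(b & L & -> & HL)]; [|now apply HP].
    apply sn_uplugs_head with [FProj true], HP. now apply interp_candidate.
  - intros K HK; apply (HK true); now apply (IHHM v g Hv Hg).
  - intros K HK; apply (HK false); now apply (IHHM v g Hv Hg).
  (* The bound type variable is interpreted by the candidate of the packed type [s]. *)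
  - intros K HK; apply (HK (interp s v)); [now apply interp_candidate|].
    rewrite <- interp_inst; now apply (IHHM v g Hv Hg).
  - assert (HP : forall X K, candidate X -> interp t (scons X v) K ->
              sn (uplugs (UPair (usubst g (erase M)) (usubst g (erase M)))
                         (FProj true :: K))).
    { intros X K HX HK.
      assert (HR : realizes (interp t (scons X v)) (usubst g (erase M)))
        by (apply IHHM; [now apply candidates_scons|now apply Hshift]).
      apply sn_beta_pair; [| |now apply HR];
        (eapply realizes_sn; [|exact HR]; auto using interp_candidate, candidates_scons). }
    intros K [->|(X & L & -> & HX & HL)]; [|now apply HP with X].
    apply sn_uplugs_head with [FProj true]; apply HP with ksn; [apply candidate_ksn|].
    apply interp_candidate; auto using candidates_scons, candidate_ksn.
  - intros K HK. apply (IHHM1 v g Hv Hg (FApp _ :: K)).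
    right; do 2 eexists; split; [reflexivity|]. split; [now apply (IHHM2 v g Hv Hg)|exact HK].
  - intros K HK. apply (IHHM v g Hv Hg (FProj true :: K)).
    right; do 2 eexists; split; [reflexivity|exact HK].
  - intros K HK. apply (IHHM v g Hv Hg (FProj false :: K)).
    right; do 2 eexists; split; [reflexivity|exact HK].
  - apply realizes_case with (interp s v) (interp t v);
      [now apply interp_candidate|now apply interp_candidate|now apply (IHHM1 v g Hv Hg)| |];
      intros A HA; rewrite uinst_uup; [apply IHHM2|apply IHHM3]; auto; now apply Hcons.
  - intros K HK. apply (IHHM1 v g Hv Hg (FCase _ _ :: K)). intros X A HX HA.
    assert (HR : sn (uplugs (uinst (usubst (uup g) (erase N)) A) K)).
    { rewrite uinst_uup. specialize (IHHM2 (scons X v) (scons A g)).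
      (* The result type does not mention the unpacked type variable, so its stacks are independent
         of [X]. *)
      rewrite interp_shift in IHHM2.
      apply IHHM2; [now apply candidates_scons|now apply Hcons, Hshift|exact HK]. }
    assert (HA' : sn A).
    { eapply realizes_sn; [|exact HA]; auto using interp_candidate, candidates_scons. }
    (* The two erased branches are equal, so the same argument serves for both. *)
    now apply (sn_beta_inj true A A).
  - rewrite interp_inst. intros K HK. apply (IHHM v g Hv Hg (FProj true :: K)).
    right; do 2 eexists; split; [reflexivity|].
    split; [|exact HK]. now apply interp_candidate.
  - intros K HK. apply (IHHM v g Hv Hg (FEps :: K)), ksn_eps.
    now apply (interp_candidate t v Hv).
Qed.

(** * Simulation of typed reduction on erased terms *)

Lemma erase_plug M E : erase (plug M E) = uplug (erase M) (erase_elim E).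
Proof. now destruct E. Qed.

Lemma erase_ren r M : erase (tm_ren r M) = uren r (erase M).
Proof. revert r; induction M; intros r; simpl; congruence. Qed.

Lemma erase_tsubst f M : erase (tm_tsubst f M) = erase M.
Proof. revert f; induction M; intros f; simpl; congruence. Qed.

Lemma erase_subst f M : erase (tm_subst f M) = usubst (fun n => erase (f n)) (erase M).
Proof.
  assert (Hup : forall g, (fun n => erase (tm_up g n)) = uup (fun n => erase (g n))).
  { intros g; extensionality n; destruct n; [reflexivity|apply erase_ren]. }
  assert (Htup : forall g, (fun n => erase (tm_tup g n)) = fun n => erase (g n)).
  { intros g; extensionality n; apply erase_tsubst. }
  revert f; induction M; intros f; simpl;
    rewrite ?IHM, ?IHM1, ?IHM2, ?IHM3, ?Hup, ?Htup; reflexivity.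
Qed.

Lemma erase_inst M A : erase (tm_inst M A) = uinst (erase M) (erase A).
Proof. unfold tm_inst; rewrite erase_subst; apply usubst_ext; now intros [|n]. Qed.

Lemma erase_elim_shift E : erase_elim (elim_shift E) = fshift (erase_elim E).
Proof. destruct E; simpl; unfold tm_shift; now rewrite ?erase_ren. Qed.

Lemma erase_elim_tshift E : erase_elim (elim_tshift E) = erase_elim E.
Proof. destruct E; simpl; unfold tm_tshift; now rewrite ?erase_tsubst. Qed.

Lemma beta_rule_erase M N : beta_rule M N -> step (erase M) (erase N).
Proof.
  destruct 1; simpl; unfold tm_tinst; rewrite ?erase_inst, ?erase_tsubst.
  - apply (step_cut _ (FApp _)), cut_lam.
  - apply (step_cut _ (FProj _)), (cut_pair true).
  - apply (step_cut _ (FProj _)), (cut_pair false).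
  - apply (step_cut _ (FCase _ _)), (cut_inj true).
  - apply (step_cut _ (FCase _ _)), (cut_inj false).
  - apply (step_cut _ (FCase _ _)), (cut_inj true).
  - apply (step_cut _ (FProj _)), (cut_pair true).
Qed.

(** Each commutative rule erases to one fusion. The existential pattern fuses as a case with equal
    branches, its type shift being erased. *)
Lemma comm_rule_erase G M N : comm_rule G M N -> step (erase M) (erase N).
Proof.
  destruct 1; rewrite erase_plug; apply step_cut; simpl;
    rewrite ?erase_plug, ?erase_elim_shift, ?erase_elim_tshift.
  - apply (cut_fuse _ (FCase _ _) _ (FCase _ _)), fuse_case.
  - apply (cut_fuse _ FEps _ FEps), fuse_eps.
  - apply (cut_fuse _ (FCase _ _) _ (FCase _ _)), fuse_case.
Qed.

(** At least one step is required: a simulation allowing zero steps would not transfer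
    termination. *)
Notation steps1 := (clos_trans _ step).

Lemma steps1_map (h : uterm -> uterm) M N :
  (forall A B, step A B -> step (h A) (h B)) -> steps1 M N -> steps1 (h M) (h N).
Proof. intros Hh; induction 1; [apply t_step; auto|eapply t_trans; eauto]. Qed.

Lemma compat_erase R G M N :
  (forall G M N, R G M N -> step (erase M) (erase N)) ->
  compat R G M N -> steps1 (erase M) (erase N).
Proof.
  intros HR; induction 1; simpl.
  - apply t_step; eauto.
  - apply (steps1_map ULam); auto using step_lam.
  - apply (steps1_map (fun X => UPair X _)); auto using step_pairL.
  - apply (steps1_map (UPair _)); auto using step_pairR.
  - apply (steps1_map (UInj _)); auto using step_inj.
  - apply (steps1_map (UInj _)); auto using step_inj.
  - apply (steps1_map (UInj _)); auto using step_inj.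
  - apply t_trans with (UPair (erase M') (erase M)).
    + apply (steps1_map (fun X => UPair X _)); auto using step_pairL.
    + apply (steps1_map (UPair _)); auto using step_pairR.
  - apply (steps1_map (fun X => uplug X (FApp _))); auto using step_head.
  - apply (steps1_map (fun X => uplug _ (FApp X))); auto using step_frame, fstep_app.
  - apply (steps1_map (fun X => uplug X (FProj _))); auto using step_head.
  - apply (steps1_map (fun X => uplug X (FProj _))); auto using step_head.
  - apply (steps1_map (fun X => uplug X (FCase _ _))); auto using step_head.
  - apply (steps1_map (fun X => uplug _ (FCase X _))); auto using step_frame, fstep_caseL.
  - apply (steps1_map (fun X => uplug _ (FCase _ X))); auto using step_frame, fstep_caseR.
  - apply (steps1_map (fun X => uplug X (FCase _ _))); auto using step_head.
  - apply t_trans with (UCase (erase M) (erase N') (erase N)).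
    + apply (steps1_map (fun X => uplug _ (FCase X _))); auto using step_frame, fstep_caseL.
    + apply (steps1_map (fun X => uplug _ (FCase _ X))); auto using step_frame, fstep_caseR.
  - apply (steps1_map (fun X => uplug X (FProj _))); auto using step_head.
  - apply (steps1_map (fun X => uplug X FEps)); auto using step_head.
Qed.

Lemma red_erase G M N : red G M N -> steps1 (erase M) (erase N).
Proof.
  intros [H|H]; eapply compat_erase; try exact H; simpl;
    eauto using beta_rule_erase, comm_rule_erase.
Qed.

(** Splitting off the first step of a nonempty sequence leads to a reduct covered by the induction
    hypothesis. *)
Lemma sn_terminating_steps1 M : sn M -> terminating steps1 M.
Proof.
  induction 1 as [M _ IH]; constructor; intros N HN.
  apply clos_trans_t1n in HN.
  destruct HN as [N HN|P N HP HN]; [now apply IH|].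
  apply (IH P HP), clos_t1n_trans, HN.
Qed.

Lemma terminating_no_infinite_sequence {X : Type} (R : X -> X -> Prop) x :
  terminating R x -> ~ exists f : nat -> X, f 0 = x /\ forall n, R (f n) (f (S n)).
Proof.
  induction 1 as [x _ IH]; intros (f & <- & Hf).
  apply (IH (f 1) (Hf 0)). exists (fun n => f (S n)); auto.
Qed.

Theorem theorem23 (G : ctx) (M : tm) (t : ty) (HM : has_type G M t) :
  ~ exists f : nat -> tm, f 0 = M /\ forall n : nat, red G (f n) (f (S n)).
Proof.
  apply terminating_no_infinite_sequence.
  apply (terminating_preimage (red G) steps1 erase); [apply red_erase|].
  apply sn_terminating_steps1.
  (* Every type variable is interpreted by [ksn] and every term variable by itself, since variables
     realize all candidates. *)
  assert (Hv : candidates (fun _ => ksn)) by (intros n; apply candidate_ksn).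
  rewrite <- usubst_id; apply realizes_sn with (interp t (fun _ => ksn)).
  - now apply interp_candidate.
  - apply realizes_erase with G; auto. intros x s _.
    now apply realizes_var, interp_candidate.
Qed.
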